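(* Let $n\ge 1$ and let $L,\overline{L}$ be a diametral pair of linear extensions of the Boolean lattice $B_n$. Let $\sigma$ be the permutation of $[n]$ giving the order in which the atoms $\{1\},\dots,\{n\}$ appear in $L$. Then $L=L_\sigma$ and $\overline{L}=L_{\overline{\sigma}}$. In particular, the diametral pairs of linear extensions of $B_n$ are exactly the pairs $L_\sigma,L_{\overline{\sigma}}$ and are unique up to isomorphism.
   Context: $B_n$ is the poset of all subsets of $[n]$ ordered by inclusion. For a permutation $\sigma$ of $[n]$, $i<_\sigma j$ means $\sigma^{-1}(i)<\sigma^{-1}(j)$, $\max_\sigma S$ is the $\sigma$-largest element of $S$, and $L_\sigma$ is the linear extension of $B_n$ with $S<T$ iff $\max_\sigma(S\triangle T)\in T$. $\overline{\sigma}$ is the reverse of $\sigma$. The distance between two linear extensions is the number of unordered pairs appearing in different orders in them; a diametral pair is a pair of linear extensions of maximum distance. *)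

(* Defs.v *)
From mathcomp Require Import all_boot all_fingroup.

Set Implicit Arguments.
Unset Strict Implicit.
Unset Printing Implicit Defensive.

Section LinearExtensions.
Variables (T : finType) (le : rel T).

(* Orders are given in their reflexive form [L x y] ("x is at or before y"). *)
Definition linear_extension (L : rel T) : Prop :=
  [/\ reflexive L, antisymmetric L, transitive L, total L
    & forall x y, le x y -> L x y].

(* The unordered pairs of distinct elements are the 2-element subsets. *)
Definition le_distance (L1 L2 : rel T) : nat :=
  #|[set p : {set T} | (#|p| == 2) &&
      [exists x in p, exists y in p, [&& x != y, L1 x y & L2 y x]]]|.

Definition diametral_pair (L1 L2 : rel T) : Prop :=
  [/\ linear_extension L1, linear_extension L2
    & forall M1 M2 : rel T, linear_extension M1 -> linear_extension M2 ->
        le_distance M1 M2 <= le_distance L1 L2].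

Definition order_automorphism (f : T -> T) : Prop :=
  bijective f /\ forall x y, le (f x) (f y) = le x y.

Definition isomorphic_pairs (L1 L2 M1 M2 : rel T) : Prop :=
  exists f : T -> T, [/\ order_automorphism f,
    forall x y, M1 (f x) (f y) = L1 x y
    & forall x y, M2 (f x) (f y) = L2 x y].

End LinearExtensions.

Section BooleanLattice.
Variable n : nat.

(* The ground set [n] is 'I_n, i.e. it is numbered from 0. *)
Definition boolean_le : rel {set 'I_n} := fun S T => S \subset T.

Definition symdiff (S T : {set 'I_n}) : {set 'I_n} := (S :\: T) :|: (T :\: S).

Definition perm_lt (s : 'S_n) (i j : 'I_n) : bool := (s^-1)%g i < (s^-1)%g j.

(* The s-largest element of S; None iff S is empty. *)
Definition perm_max (s : 'S_n) (S : {set 'I_n}) : option 'I_n :=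
  [pick i in S | [forall j in S, (j != i) ==> perm_lt s j i]].

(* Reflexive closure of: S < T iff the s-largest element of the symmetric
   difference of S and T lies in T. *)
Definition L_perm (s : 'S_n) : rel {set 'I_n} := fun S T =>
  (S == T) || (if perm_max s (symdiff S T) is Some i then i \in T else false).

Lemma rev_perm_inj (s : 'S_n) : injective (fun k : 'I_n => s (rev_ord k)).
Proof. by move=> k l /perm_inj /rev_ord_inj. Qed.

Definition rev_perm (s : 'S_n) : 'S_n := perm (@rev_perm_inj s).

(* In L the atoms appear in the order {s 0}, {s 1}, ..., {s (n-1)}. *)
Definition atom_order (L : rel {set 'I_n}) (s : 'S_n) : Prop :=
  forall k l : 'I_n, L [set s k] [set s l] = (k <= l).

End BooleanLattice.

(* Main.v *)
(* Group the ordered pairs (A, B) that L and L' reverse by D, the symmetric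
   difference of A and B, and by C, their intersection. In such a group the
   splits of D that L orders upwards form a down-set of the subsets of D, those
   that L' orders downwards form an up-set, and both are exchanged with their
   complements by X |-> D \ X, so they have 2^(|D|-1) members. By Kleitman's
   correlation inequality at most 2^|D| / 4 splits are reversed, and the pair
   L_s, L_(rev s) attains this bound in every group. A diametral pair is
   therefore tight in every group, and tightness forces, by induction on C and
   then on D, that the s-largest element of D wins every split of D in L, and
   the s-smallest one in L'. *)

Require Import Defs.
From mathcomp Require Import all_boot all_fingroup.
From mathcomp Require Import zify.

Set Implicit Arguments.
Unset Strict Implicit.
Unset Printing Implicit Defensive.

(** * Kleitman's correlation inequality for families of subsets *)

Section Kleitman.
Variable T : finType.
Implicit Types (A B C D X Y : {set T}) (x : T) (F U : pred {set T}).

Definition down_closed F := forall X Y, X \subset Y -> F Y -> F X.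
Definition up_closed F := forall X Y, X \subset Y -> F X -> F Y.

Lemma card_powersetU1 F x A : x \notin A ->
  #|[set X in powerset (x |: A) | F X]| =
  #|[set X in powerset A | F X]| + #|[set X in powerset A | F (x |: X)]|.
Proof.
move=> xA; rewrite -(cardsID [set X : {set T} | x \in X]) addnC; congr (_ + _).
  apply: eq_card => X; rewrite !inE; case: (boolP (x \in X)) => xX /=.
    by case: (boolP (X \subset A)) => // /subsetP /(_ x xX); rewrite (negPf xA).
  congr (_ && _); apply/idP/idP => /subsetP sXA; apply/subsetP=> y yX.
    have := sXA y yX; rewrite !inE => /predU1P [yx | //].
    by rewrite -yx yX in xX.
  by rewrite !inE sXA ?orbT.
rewrite -(@card_in_imset _ _ (fun X => x |: X)
  [set X in powerset A | F (x |: X)]) => [|X Y].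
  apply: eq_card => X; rewrite !inE; apply/idP/imsetP.
    case/andP=> /andP [sXA FX] xX; exists (X :\ x); last by rewrite setD1K.
    by rewrite !inE setD1K // FX subDset sXA.
  case=> Y; rewrite !inE => /andP [sYA FY] ->.
  by rewrite setU11 setUS // FY.
rewrite !inE => /andP [sXA _] /andP [sYA _] E.
have xX : x \notin X by apply: contra xA; apply: (subsetP sXA).
have xY : x \notin Y by apply: contra xA; apply: (subsetP sYA).
by rewrite -(setU1K xX) E setU1K.
Qed.

(* Splitting on a point [x] reduces the claim to Chebyshev's inequality for the
   two halves: passing to the upper half shrinks [F] and enlarges [U]. *)
Lemma kleitman F U D : down_closed F -> up_closed U ->
  2 ^ #|D| * #|[set X in powerset D | F X && U X]| <=
  #|[set X in powerset D | F X]| * #|[set X in powerset D | U X]|.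
Proof.
have [d] := ubnP #|D|; elim: d F U D => // d IHd F U D ltD dF uU.
have [->|[x xD]] := set_0Vmem D.
  have -> : powerset (set0 : {set T}) = [set set0] by apply: powerset0.
  rewrite cards0 mul1n.
  have E (P : pred {set T}) : #|[set X in [set set0] | P X]| = P set0.
    case: (boolP (P set0)) => P0.
      by apply/eqP/cards1P; exists set0; apply/setP=> X; rewrite !inE; case: eqP => // ->.
    by apply/eqP; rewrite cards_eq0; apply/eqP/setP=> X; rewrite !inE;
       case: eqP => // ->; rewrite (negPf P0).
  by rewrite !E; case: (F _); case: (U _).
rewrite -(setD1K xD) !card_powersetU1 ?setD11 //.
have ltD1 : #|D :\ x| < d by move: ltD; rewrite (cardsD1 x D) xD; lia.
rewrite cardsU1 setD11 /=.
set F1 := fun X => F (x |: X); set U1 := fun X => U (x |: X).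
have dF1 : down_closed F1 by move=> X Y sXY; apply: dF; apply: setUS.
have uU1 : up_closed U1 by move=> X Y sXY; apply: uU; apply: setUS.
have := IHd F U _ ltD1 dF uU; have := IHd F1 U1 _ ltD1 dF1 uU1.
have lF : #|[set X in powerset (D :\ x) | F1 X]| <= #|[set X in powerset (D :\ x) | F X]|.
  apply/subset_leq_card/subsetP=> X; rewrite !inE => /andP [->] /=.
  by apply: dF; apply: subsetU1.
have lU : #|[set X in powerset (D :\ x) | U X]| <= #|[set X in powerset (D :\ x) | U1 X]|.
  apply/subset_leq_card/subsetP=> X; rewrite !inE => /andP [->] /=.
  by apply: uU; apply: subsetU1.
(* For half sizes [f1 <= f0] and [u0 <= u1], the product [(f0 + f1) * (u0 + u1)] exceeds
   [2 * (f0 * u0 + f1 * u1)] by [(f0 - f1) * (u1 - u0)]. *)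
move: lF lU; rewrite /F1 /U1 expnS /=.
by move: #|D :\ x| => k; nia.
Qed.

Definition self_dual D F := forall X, X \subset D -> F (D :\: X) = ~~ F X.

Lemma setDDsub D X : X \subset D -> D :\: (D :\: X) = X.
Proof. by move=> sXD; rewrite setDDr setDv set0U; apply/setIidPr. Qed.

(** Complementation in [D] is a bijection between the members and the non-members of [F]. *)
Lemma card_self_dual D F : self_dual D F ->
  #|[set X in powerset D | F X]| * 2 = 2 ^ #|D|.
Proof.
move=> sdF; rewrite -card_powerset -(cardsID [set X | F X] (powerset D)) muln2 -addnn.
have -> : [set X in powerset D | F X] = powerset D :&: [set X | F X].
  by apply/setP => X; rewrite !inE.
congr (_ + _); rewrite -(@card_in_imset _ _ (fun X => D :\: X)
  (powerset D :&: [set X | F X])) => [|X Y].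
  apply: eq_card => X; rewrite !inE; apply/imsetP/idP.
    by case=> Y; rewrite !inE => /andP [sYD FY] ->; rewrite sdF // FY subsetDl.
  case/andP=> nFX sXD; exists (D :\: X); last by rewrite setDDsub.
  by rewrite !inE subsetDl sdF.
by rewrite !inE => /andP [sXD _] /andP [sYD _] E; rewrite -(setDDsub sXD) E setDDsub.
Qed.

(** Both families hold half of the [2 ^ #|D|] subsets, so Kleitman's inequality leaves at most a
    quarter in common. *)
Lemma card_self_dual_pair D F U : down_closed F -> up_closed U ->
  self_dual D F -> self_dual D U ->
  #|[set X in powerset D | F X && U X]| * 4 <= 2 ^ #|D|.
Proof.
move=> dF uU sF sU; have := @kleitman F U D dF uU.
have := card_self_dual sF; have := card_self_dual sU.
have : 0 < 2 ^ #|D| by rewrite expn_gt0.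
nia.
Qed.

End Kleitman.

(** * Distance as a count of ordered pairs *)

Lemma le_distanceC (T : finType) (L L' : rel T) : le_distance L L' = le_distance L' L.
Proof.
apply: eq_card => p; rewrite !inE; congr (_ && _).
apply/exists_inP/exists_inP => [] [x xp /exists_inP [y yp /and3P [xy Lxy L'yx]]];
  by exists y => //; apply/exists_inP; exists x => //; rewrite eq_sym xy L'yx.
Qed.

Lemma eq_le_distance (T : finType) (L L' M M' : rel T) :
  L =2 M -> L' =2 M' -> le_distance L L' = le_distance M M'.
Proof.
move=> eL eL'; apply: eq_card => p; rewrite !inE; congr (_ && _).
apply: eq_existsb => x; congr (_ && _); apply: eq_existsb => y.
by rewrite eL eL'.
Qed.

(** Antisymmetry of [L] leaves one orientation of each reversed pair, so forgetting the orientation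
    is injective. *)
Lemma le_distanceE (T : finType) (L L' : rel T) : antisymmetric L ->
  le_distance L L' = #|[set p : T * T | [&& p.1 != p.2, L p.1 p.2 & L' p.2 p.1]]|.
Proof.
move=> aL; rewrite -(@card_in_imset _ _ (fun p : T * T => [set p.1; p.2])
  [set p : T * T | [&& p.1 != p.2, L p.1 p.2 & L' p.2 p.1]]) => [|[x y] [x' y']].
  apply: eq_card => p; rewrite !inE; apply/andP/imsetP.
    case=> /cards2P [a [b [nab ->]]] /exists_inP [x xp /exists_inP [y yp H]].
    exists (x, y); first by rewrite inE.
    move: xp yp H => /= /set2P [] -> /set2P [] -> //; rewrite ?eqxx //.
    by rewrite setUC.
  case=> [[x y]]; rewrite inE /= => /and3P [xy Lxy L'yx] ->.
  rewrite cards2 xy; split=> //; apply/exists_inP; exists x; rewrite ?set21 //.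
  by apply/exists_inP; exists y; rewrite ?set22 ?xy ?Lxy.
rewrite !inE /= => /and3P [xy Lxy _] /and3P [xy' Lxy' _] E.
have : x \in [set x'; y'] by rewrite -E set21.
have : y \in [set x'; y'] by rewrite -E set22.
case/set2P=> ey /set2P [] ex; subst x y => //; rewrite ?eqxx // in xy *.
by rewrite (aL x' y') ?Lxy ?Lxy' // in xy'; rewrite eqxx in xy'.
Qed.

(** * Grouping reversed pairs into splits; the upper bound on the distance *)

Section Splits.
Variable T : finType.
Implicit Types (A B C D X Y : {set T}) (L : rel {set T}).

(** On ['I_n] this is convertible with [boolean_le], so the results below apply to it directly. *)
Definition subset_le : rel {set T} := fun A B => A \subset B.

Definition reversed_splits L L' D C :=
  [set X in powerset D |
    L (X :|: C) (D :\: X :|: C) && L' (D :\: X :|: C) (X :|: C)].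

(* A pair [A], [B] is encoded by [D], the symmetric difference, by [C], the
   intersection, and by the split of [D] into [A :\: B] and [B :\: A]. *)
Lemma le_distance_splits L L' : antisymmetric L ->
  le_distance L L' =
  \sum_(q : {set T} * {set T} | (q.1 != set0) && [disjoint q.1 & q.2])
     #|reversed_splits L L' q.1 q.2|.
Proof.
move=> aL; rewrite le_distanceE // -sum1_card.
pose h (p : {set T} * {set T}) :=
  ((p.1 :\: p.2) :|: (p.2 :\: p.1), p.1 :&: p.2).
(* The fibre of [h] over [(D, C)] corresponds to the reversed splits by
   [X |-> (X :|: C, D :\: X :|: C)], injective because [C] misses [D]. *)
rewrite (partition_big h (fun q => (q.1 != set0) && [disjoint q.1 & q.2])) /=.
  apply: eq_bigr => [[D C]] /= /andP [D0 dDC].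
  rewrite sum1_card -(@card_in_imset _ _
    (fun X => (X :|: C, D :\: X :|: C)) (reversed_splits L L' D C)).
    apply: eq_card => -[A B]; rewrite unfold_in /= inE /=.
    apply/idP/imsetP.
      case/andP=> /and3P [nAB LAB LBA] /eqP [eD eC]; exists (A :\: B).
        rewrite !inE -eD -eC subsetUl /=.
        have -> : A :\: B :|: A :&: B = A.
          by apply/setP=> z; rewrite !inE; case: (z \in A); case: (z \in B).
        have -> : (A :\: B :|: B :\: A) :\: (A :\: B) :|: A :&: B = B.
          by apply/setP=> z; rewrite !inE; case: (z \in A); case: (z \in B).
        by rewrite LAB.
      by congr (_, _); apply/setP=> z; rewrite -?eD -?eC !inE;
        case: (z \in A); case: (z \in B).
    case=> X; rewrite !inE => /and3P [/subsetP sXD LX L'X] [-> ->].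
    rewrite LX L'X /= andbT.
    have inC z : (z \in C) && (z \in D) = false.
      by apply/negP=> /andP [zC zD]; rewrite (disjointFr dDC zD) in zC.
    have inX z : (z \in X) ==> (z \in D) by apply/implyP; apply: sXD.
    apply/andP; split; last first.
      apply/eqP; congr (_, _); apply/setP=> z; move: (inC z) (inX z);
        by rewrite !inE; case: (z \in X); case: (z \in C); case: (z \in D).
    case/set0Pn: D0 => z zD; apply/eqP => /setP /(_ z).
    by move: (inC z); rewrite !inE zD andbT => ->; case: (z \in X).
  move=> X Y; rewrite !inE => /andP [/subsetP sXD _] /andP [/subsetP sYD _] [+ _].
  move/setP=> E; apply/setP=> z; have := E z; rewrite !inE.
  case: (boolP (z \in C)) => [zC _|_]; last by rewrite !orbF.
  have nzD : z \notin D by apply/negP=> zD; rewrite (disjointFr dDC zD) in zC.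
  by rewrite (contraNF (sXD z) nzD) (contraNF (sYD z) nzD).
move=> [A B]; rewrite inE /= => /and3P [nAB _ _]; apply/andP; split.
  by apply: contraNneq nAB; move/eqP; rewrite setU_eq0 !setD_eq0 eqEsubset.
rewrite -setI_eq0; apply/eqP/setP=> z; rewrite !inE.
by case: (z \in A); case: (z \in B).
Qed.

Section Pair.
Variable L : rel {set T}.
Hypothesis leL : linear_extension subset_le L.

Lemma linear_extension_anti : antisymmetric L.
Proof. by case: leL. Qed.

Lemma linear_extension_sub A B : A \subset B -> L A B.
Proof. by case: leL => _ _ _ _; apply. Qed.

Lemma linear_extension_trans A' B' A B :
  A \subset A' -> L A' B' -> B' \subset B -> L A B.
Proof.
case: leL => _ _ tL _ sL /sL LA LAB /sL LB; exact: tL LA (tL _ _ _ LAB LB).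
Qed.

Lemma linear_extension_dual A B : A != B -> L B A = ~~ L A B.
Proof.
case: leL => _ aL _ toL _ nAB; case: (boolP (L A B)) => LAB /=.
  apply/negP=> LBA; case/eqP: nAB; apply: aL; exact/andP.
by case/orP: (toL A B) => //; rewrite (negPf LAB).
Qed.

Definition split_le C D X := L (X :|: C) (D :\: X :|: C).

Lemma split_le_down C D : down_closed (split_le C D).
Proof.
by move=> X Y sXY LY; apply: linear_extension_trans LY _; rewrite setSU // setDS.
Qed.

Lemma split_neq C D X : D != set0 -> [disjoint D & C] -> X \subset D ->
  X :|: C != D :\: X :|: C.
Proof.
case/set0Pn=> z zD dDC sXD; apply/eqP => /setP /(_ z).
by rewrite !inE zD (disjointFr dDC zD) !orbF andbT; case: (z \in X).
Qed.

Lemma split_le_self_dual C D : D != set0 -> [disjoint D & C] ->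
  self_dual D (split_le C D).
Proof.
move=> D0 dDC X sXD; rewrite /split_le setDDsub //.
by rewrite linear_extension_dual // split_neq.
Qed.

End Pair.

(** Turned around with respect to [split_le], so that a reversed split satisfies [split_le L] and
    [split_ge L'], a down-set and an up-set. *)
Definition split_ge L C D X := L (D :\: X :|: C) (X :|: C).

Lemma split_ge_up L C D : linear_extension subset_le L ->
  up_closed (split_ge L C D).
Proof.
move=> leL X Y sXY LY; apply: (linear_extension_trans leL) LY _.
  by rewrite setSU // setDS.
by rewrite setSU.
Qed.

Lemma split_ge_self_dual L C D : linear_extension subset_le L ->
  D != set0 -> [disjoint D & C] -> self_dual D (split_ge L C D).
Proof.
move=> leL D0 dDC X sXD; rewrite /split_ge setDDsub //.
by rewrite (linear_extension_dual leL) // eq_sym split_neq.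
Qed.

(** For a singleton [D] the quotient is [0]; from two elements on it is exactly [2 ^ (#|D| - 2)]. *)
Lemma card_reversed_splits_le L L' D C :
  linear_extension subset_le L -> linear_extension subset_le L' ->
  D != set0 -> [disjoint D & C] ->
  #|reversed_splits L L' D C| <= 2 ^ #|D| %/ 4.
Proof.
move=> leL leL' D0 dDC; rewrite leq_divRL //.
apply: (@card_self_dual_pair T D (split_le L C D) (split_ge L' C D)).
- exact: split_le_down.
- exact: split_ge_up.
- exact: split_le_self_dual.
- exact: split_ge_self_dual.
Qed.

Definition max_distance :=
  \sum_(q : {set T} * {set T} | (q.1 != set0) && [disjoint q.1 & q.2])
    2 ^ #|q.1| %/ 4.

Lemma le_distance_max L L' :
  linear_extension subset_le L -> linear_extension subset_le L' ->
  le_distance L L' <= max_distance.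
Proof.
move=> leL leL'; rewrite le_distance_splits; last exact: linear_extension_anti leL.
by apply: leq_sum => q /andP [D0 dDC]; apply: card_reversed_splits_le.
Qed.

Definition tight L L' := forall D C, D != set0 -> [disjoint D & C] ->
  #|reversed_splits L L' D C| = 2 ^ #|D| %/ 4.

(** A sum of individually bounded terms reaches the sum of the bounds only if every term reaches its
    own. *)
Lemma tightP L L' :
  linear_extension subset_le L -> linear_extension subset_le L' ->
  le_distance L L' = max_distance <-> tight L L'.
Proof.
move=> leL leL'; rewrite le_distance_splits; last exact: linear_extension_anti leL.
split=> [E D C D0 dDC | tLL']; last first.
  by apply: eq_bigr => q /andP [D0 dDC]; apply: tLL'.
have := @leqif_sum _ (fun q : {set T} * {set T} => (q.1 != set0) && [disjoint q.1 & q.2])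
  (fun q => #|reversed_splits L L' q.1 q.2| == 2 ^ #|q.1| %/ 4)
  (fun q => #|reversed_splits L L' q.1 q.2|) (fun q => 2 ^ #|q.1| %/ 4).
case=> [q /andP [D1 dDC1] | _].
  by apply: leqif_eq; apply: card_reversed_splits_le.
rewrite E eqxx => /esym /forall_inP /(_ (D, C)) /=.
by rewrite D0 dDC => /(_ isT) /eqP.
Qed.

(** Tightness amounts to a distance equal to [max_distance], and the distance is symmetric. *)
Lemma tightC L L' :
  linear_extension subset_le L -> linear_extension subset_le L' ->
  tight L L' -> tight L' L.
Proof. by move=> leL leL' /(tightP leL leL'); rewrite le_distanceC => /tightP; apply. Qed.

End Splits.

(** * Tightness: the top element decides every split *)

Section Tight.
Variable T : finType.
Implicit Types (A B C D X Y : {set T}) (L : rel {set T}) (r : T -> nat).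

Lemma exists_rank_max r D : D != set0 ->
  exists2 M, M \in D & forall j, j \in D -> r j <= r M.
Proof. by case/set0Pn=> x xD; case: (arg_maxnP r xD) => M MD maxM; exists M. Qed.

(* If the top element [M] of [D] did not beat the rest of [D], the splits won
   by [X] in [L] would be those with [M \notin X], except that [D :\ M] is
   traded for [[set M]]. As [L'] puts [M] first, this trade loses one reversed
   split compared with a family that already obeys the bound [2 ^ #|D| / 4]. *)
Lemma tight_top L L' r C :
  linear_extension (@subset_le T) L -> linear_extension (@subset_le T) L' ->
  tight L L' -> injective r ->
  (forall i j, i \notin C -> j \notin C -> r i < r j -> L' (j |: C) (i |: C)) ->
  forall D M, [disjoint D & C] -> M \in D -> (forall j, j \in D -> r j <= r M) ->
  L (D :\ M :|: C) (M |: C).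
Proof.
move=> leL leL' tLL' injr base D M.
have [d] := ubnP #|D|; elim: d D => // d IHd D ltD dDC MD maxM.
have D0 : D != set0 by apply/set0Pn; exists M.
have eDM : D :\: (D :\ M) = [set M] by rewrite setDDsub // sub1set.
have [D1 | [x]] := set_0Vmem (D :\ M).
  by rewrite D1 set0U; apply: (linear_extension_sub leL); apply: subsetU1.
rewrite !inE => /andP [nxM xD].
case: (boolP (L (D :\ M :|: C) (M |: C))) => // nL.
(* Such an [X] misses some [y] of [D] other than [M]. By induction [M] beats the rest of [D :\ y],
   which contains [X], while [M] lies in the complement of [X]. *)
have winX X : X \subset D -> M \notin X -> X != D :\ M -> split_le L C D X.
  move=> sXD MX nX.
  have sX : X \proper D :\ M.
    by rewrite properEneq nX subsetD1 sXD.
  case/properP: sX => sX [y]; rewrite !inE => /andP [nyM yD] nyX.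
  have LDy : L (D :\ y :\ M :|: C) (M |: C).
    apply: IHd.
    - by move: ltD; rewrite (cardsD1 y D) yD add1n ltnS.
    - by apply: disjointWl dDC; apply: subsetDl.
    - by rewrite !inE eq_sym nyM.
    - by move=> j; rewrite !inE => /andP [_ /maxM].
  apply: (linear_extension_trans leL) LDy _; apply: setSU.
    by rewrite setDDl setUC -setDDl subsetD1 sX.
  by rewrite sub1set !inE MX.
have L'M : L' (M |: C) (D :\ M :|: C).
  apply: (linear_extension_trans leL' (subxx _) (B' := x |: C)).
    apply: base; rewrite ?(disjointFr dDC) //.
    rewrite ltn_neqAle maxM // andbT.
    by apply: contra nxM => /eqP /injr ->.
  by rewrite setSU // sub1set !inE nxM.
have LM : L (M |: C) (D :\ M :|: C).
  rewrite (linear_extension_dual leL) //.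
  by have := @split_neq T C D (D :\ M) D0 dDC (subsetDl _ _); rewrite eDM.
(* If a reversed [X] contains [M], its complement does not win in [L], so [winX] leaves only [X =
   [set M]], which [L'M] excludes. *)
have sub_rev : D :\ M |: reversed_splits L L' D C \subset
    [set X in powerset D | (M \notin X) && split_ge L' C D X].
  apply/subsetP=> X; rewrite !inE => /predU1P [-> | /and3P [sXD LX L'X]].
    by rewrite subsetDl !inE eqxx /= /split_ge eDM.
  rewrite sXD /= [split_ge _ _ _ _]L'X andbT; apply/negP => MX.
  case: (eqVneq (D :\: X) (D :\ M)) => [eDX | nDX].
    have eX : X = [set M] by rewrite -(setDDsub sXD) eDX.
    have := linear_extension_dual leL' (@split_neq T C D X D0 dDC sXD).
    by rewrite L'X eX L'M.
  have := winX (D :\: X) (subsetDl _ _); rewrite !inE MX => /(_ isT nDX).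
  by rewrite (split_le_self_dual leL D0 dDC sXD) [split_le _ _ _ _]LX.
have nrev : D :\ M \notin reversed_splits L L' D C.
  by rewrite !inE eDM (negPf nL) andbF.
(* The condition [M \notin X] is itself a self-dual down-set, so the quarter bound applies to it. *)
have le4 : #|[set X in powerset D | (M \notin X) && split_ge L' C D X]| * 4 <= 2 ^ #|D|.
  apply: (@card_self_dual_pair T D (fun X => M \notin X) (split_ge L' C D)).
  - by move=> X Y /subsetP sXY; apply: contra; apply: sXY.
  - exact: split_ge_up.
  - by move=> X _; rewrite !inE MD andbT.
  - exact: split_ge_self_dual.
have := leq_trans (subset_leq_card sub_rev) (_ : _ <= 2 ^ #|D| %/ 4).
by rewrite cardsU1 nrev tLL' // leq_divRL // add1n ltnn => /(_ le4).
Qed.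

(** For [D = [set i; j]] the tight count is [4 %/ 4 = 1], so some split is reversed. Splits by the
    empty set or by [D] compare nested sets, which both extensions order alike; a singleton remains,
    and [L] tells which. *)
Lemma tight_swap L L' C i j :
  linear_extension (@subset_le T) L -> linear_extension (@subset_le T) L' ->
  tight L L' -> i != j -> i \notin C -> j \notin C ->
  L (i |: C) (j |: C) -> L' (j |: C) (i |: C).
Proof.
move=> leL leL' tLL' nij iC jC Lij.
have dC : [disjoint [set i; j] & C].
  by rewrite -setI_eq0; apply/eqP/setP=> z; rewrite !inE;
     case: eqP => [->|_]; [rewrite (negPf iC) | case: eqP => // ->; rewrite (negPf jC)].
have D0 : [set i; j] != set0 by apply/set0Pn; exists i; rewrite set21.
have ei : [set i; j] :\: [set i] = [set j].
  by apply/setP=> z; rewrite !inE; case: (eqVneq z i) => // ->; rewrite (negPf nij).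
have ej : [set i; j] :\: [set j] = [set i].
  by rewrite setUC; apply/setP=> z; rewrite !inE; case: (eqVneq z j) => // ->; rewrite eq_sym (negPf nij).
have : 0 < #|reversed_splits L L' [set i; j] C| by rewrite tLL' // cards2 nij.
case/card_gt0P=> X; rewrite !inE => /and3P [sX LX L'X].
have nX := @split_neq T C _ X D0 dC sX.
have nsX : ~~ (X :|: C \subset [set i; j] :\: X :|: C).
  apply/negP => /(linear_extension_sub leL').
  by rewrite (linear_extension_dual leL') ?L'X // eq_sym.
have nsX' : ~~ ([set i; j] :\: X :|: C \subset X :|: C).
  apply/negP => /(linear_extension_sub leL).
  by rewrite (linear_extension_dual leL) ?LX.
have [iX | iX] := boolP (i \in X); have [jX | jX] := boolP (j \in X).
- by case/negP: nsX'; rewrite setSU //; apply/subsetP=> z; rewrite !inE => /andP [_] /orP [] /eqP ->.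
- have eX : X = [set i].
    by apply/eqP; rewrite eqEsubset sub1set iX -ej subsetD1 sX jX.
  by rewrite eX ei in L'X.
- have eX : X = [set j].
    by apply/eqP; rewrite eqEsubset sub1set jX -ei subsetD1 sX iX.
  have := linear_extension_dual leL nX; rewrite LX eX ej.
  by rewrite Lij.
- case/negP: nsX; rewrite setSU //; apply/subsetP=> z zX.
  by have := subsetP sX z zX; rewrite !inE => /orP [] /eqP ez; rewrite ez in zX;
     rewrite zX in iX jX.
Qed.

(* Moving one element [c] of [C] into the split [{i, j}] decides the pair in
   [L] when [c] is below [j], and in [L'] when [c] is above [i]. *)
Lemma tight_base L L' r r' C :
  linear_extension (@subset_le T) L -> linear_extension (@subset_le T) L' ->
  tight L L' -> injective r -> (forall i j, (r' i <= r' j) = (r j <= r i)) ->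
  (forall i j, r i < r j -> L [set i] [set j]) ->
  forall i j, i \notin C -> j \notin C -> r i < r j ->
  L (i |: C) (j |: C) /\ L' (j |: C) (i |: C).
Proof.
move=> leL leL' tLL' injr rr' atomL.
have tL'L := tightC leL leL' tLL'.
have injr' : injective r'.
  by move=> i j e; apply: injr; apply/eqP; rewrite eqn_leq -!rr' e leqnn.
have neq i j : r i < r j -> i != j by apply: contraTneq => ->; rewrite ltnn.
have [d] := ubnP #|C|; elim: d C => // d IHd C ltC i j iC jC rij.
have nij := neq _ _ rij.
have [C0 | [c cC]] := set_0Vmem C.
  have Lij : L (i |: C) (j |: C) by rewrite C0 !setU0 atomL.
  by split=> //; apply: (tight_swap leL leL' tLL').
have base := IHd (C :\ c) _.
have {}base : forall i j, i \notin C :\ c -> j \notin C :\ c -> r i < r j ->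
    L (i |: C :\ c) (j |: C :\ c) /\ L' (j |: C :\ c) (i |: C :\ c).
  by apply: base; move: ltC; rewrite (cardsD1 c C) cC add1n ltnS.
have nci : c != i by apply: contraNneq iC => <-.
have ncj : c != j by apply: contraNneq jC => <-.
have dD : [disjoint [set i; j; c] & C :\ c].
  rewrite -setI_eq0; apply/eqP/setP=> z; rewrite !inE.
  case: (eqVneq z c) => [->|_]; rewrite ?andbF //=.
  case: (eqVneq z i) => [->|_]; first by rewrite (negPf iC).
  by case: (eqVneq z j) => [->|_] //=; rewrite (negPf jC).
have [rcj | rjc] := ltnP (r c) (r j).
  (* Here [j] has the largest rank, and [i], [c] together with [C :\ c] make up [i |: C]. So
     [i |: C] precedes [j |: C :\ c], a subset of [j |: C]. *)
  have H : L ([set i; j; c] :\ j :|: C :\ c) (j |: C :\ c).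
    apply: (tight_top leL leL' tLL' injr) => //.
    - by move=> a b aC bC rab; have [] := base a b aC bC rab.
    - by rewrite !inE eqxx orbT.
    - by move=> k; rewrite !inE -orbA => /or3P [] /eqP -> //; exact: ltnW.
  have Lij : L (i |: C) (j |: C).
    apply: (linear_extension_trans leL) H _; last by rewrite setUS // subsetDl.
    apply/subsetP=> z; rewrite !inE; case: (eqVneq z i) => [->|_] /=; first by rewrite nij.
    by case: (eqVneq z c) => [->|_ ->]; rewrite ?ncj ?orbT.
  by split=> //; apply: (tight_swap leL leL' tLL').
(* Now [i] has the smallest [r], hence the largest [r'], and [tight_top] applies with [L] and [L']
   exchanged. *)
have H : L' ([set i; j; c] :\ i :|: C :\ c) (i |: C :\ c).
  apply: (tight_top leL' leL tL'L injr') => //.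
  - move=> a b aC bC rab; have [] // := base b a bC aC _.
    by rewrite ltnNge -rr' -ltnNge.
  - by rewrite !inE eqxx.
  - have ric : r i < r c := leq_trans rij rjc.
    by move=> k; rewrite !inE -orbA => /or3P [] /eqP ->; rewrite rr'; [| exact: ltnW..].
have L'ji : L' (j |: C) (i |: C).
  apply: (linear_extension_trans leL') H _; last by rewrite setUS // subsetDl.
  apply/subsetP=> z; rewrite !inE; case: (eqVneq z j) => [->|_] /=; first by rewrite eq_sym nij orbT.
  by case: (eqVneq z c) => [->|_ ->]; rewrite ?nci ?orbT.
by split=> //; apply: (tight_swap leL' leL tL'L) => //; rewrite eq_sym.
Qed.

(** Let [D] be the symmetric difference and [C] the intersection. If [M \in B], then [A] lies in
    [D :\ M :|: C] and [M |: C] lies in [B]; if [M \in A], exchange the two sets. *)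
Lemma top_splits_order L r A B M :
  linear_extension (@subset_le T) L ->
  (forall C D M, [disjoint D & C] -> M \in D -> (forall j, j \in D -> r j <= r M) ->
     L (D :\ M :|: C) (M |: C)) ->
  M \in (A :\: B) :|: (B :\: A) ->
  (forall j, j \in (A :\: B) :|: (B :\: A) -> r j <= r M) -> L A B = (M \in B).
Proof.
move=> leL top.
have main (A' B' : {set T}) : M \in (A' :\: B') :|: (B' :\: A') ->
    (forall j, j \in (A' :\: B') :|: (B' :\: A') -> r j <= r M) -> M \in B' -> L A' B'.
  move=> MD maxM MB.
  have dD : [disjoint (A' :\: B') :|: (B' :\: A') & A' :&: B'].
    rewrite -setI_eq0; apply/eqP/setP=> z; rewrite !inE.
    by case: (z \in A'); case: (z \in B').
  have nMA : M \notin A' by move: MD; rewrite !inE MB; case: (M \in A').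
  apply: (linear_extension_trans leL) (top _ _ _ dD MD maxM) _.
    apply/subsetP=> z zA; rewrite !inE zA; case: (z \in B'); rewrite ?orbT //=.
    by rewrite ?orbF ?andbT; apply: contraNneq nMA => <-.
  by apply/subsetP=> z; rewrite !inE => /predU1P [-> // | /andP []].
move=> MD maxM; have [MB | MB] := boolP (M \in B); first exact: main.
have MA : M \in A by move: MD; rewrite !inE (negPf MB) andbF orbF.
have nAB : B != A by apply: contraNneq MB => ->.
rewrite (linear_extension_dual leL nAB); apply/negPn.
by apply: main => // [|j]; rewrite setUC //; apply: maxM.
Qed.

End Tight.

(** * Permutation orders and their tightness *)

Section PermOrders.
Variable n : nat.
Implicit Types (A B C D X : {set 'I_n}) (L : rel {set 'I_n}) (s t : 'S_n).

Definition perm_rank s (i : 'I_n) : nat := (s^-1)%g i.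

Lemma perm_rank_inj s : injective (perm_rank s).
Proof. by move=> i j /val_inj /perm_inj. Qed.

Lemma rev_permV s i : ((rev_perm s)^-1)%g i = rev_ord ((s^-1)%g i).
Proof. by apply: (@perm_inj _ (rev_perm s)); rewrite permKV permE rev_ordK permKV. Qed.

Lemma rev_perm_rank s i j :
  (perm_rank (rev_perm s) i <= perm_rank (rev_perm s) j) =
  (perm_rank s j <= perm_rank s i).
Proof.
rewrite /perm_rank !rev_permV /=.
have := ltn_ord ((s^-1)%g i); have := ltn_ord ((s^-1)%g j); lia.
Qed.

Lemma symdiffC A B : symdiff A B = symdiff B A.
Proof. by rewrite /symdiff setUC. Qed.

Lemma in_symdiff A B z : (z \in symdiff A B) = ((z \in A) != (z \in B)).
Proof. by rewrite !inE; case: (z \in A); case: (z \in B). Qed.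

Lemma symdiff_neq0 A B : A != B -> symdiff A B != set0.
Proof. by apply: contraNneq => /eqP; rewrite setU_eq0 !setD_eq0 eqEsubset. Qed.

(** Ranks are injective, so the element picked by [perm_max] is the given [M]; later arguments avoid
    the option type. *)
Lemma L_perm_max s A B M : M \in symdiff A B ->
  (forall j, j \in symdiff A B -> perm_rank s j <= perm_rank s M) ->
  L_perm s A B = (M \in B).
Proof.
move=> MD maxM; rewrite /L_perm.
have -> : (A == B) = false.
  by apply: contraTF MD => /eqP ->; rewrite in_symdiff eqxx.
rewrite /perm_max; case: pickP => [i /andP [iD /forall_inP maxi] | /(_ M)] /=.
  case: (eqVneq M i) => [-> // | nMi].
  have := implyP (maxi M MD) nMi; rewrite /perm_lt.
  by have := maxM i iD; rewrite /perm_rank leqNgt => /negPf ->.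
rewrite MD /= => /negP []; apply/forall_inP => j jD; apply/implyP => nj.
rewrite /perm_lt ltn_neqAle [_ <= _]maxM // andbT.
by apply: contra nj => /eqP /(@perm_rank_inj s) ->.
Qed.

(** Case analysis on it yields the deciding element and rewrites the comparisons in both directions
    at once. *)
Variant L_perm_spec s A B : bool -> bool -> Prop :=
  LPermSpec M of M \in symdiff A B
    & (forall j, j \in symdiff A B -> perm_rank s j <= perm_rank s M)
    & (M \in A) = (M \notin B) : L_perm_spec s A B (M \in B) (M \notin B).

Lemma L_permP s A B : A != B -> L_perm_spec s A B (L_perm s A B) (L_perm s B A).
Proof.
move=> /symdiff_neq0 /(exists_rank_max (perm_rank s)) [M MD maxM].
have MAB : (M \in A) = (M \notin B).
  by move: MD; rewrite in_symdiff; case: (M \in A); case: (M \in B).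
rewrite (L_perm_max MD maxM) (@L_perm_max s B A M) ?(symdiffC B) // MAB.
by constructor.
Qed.

Lemma L_perm_linear_extension s : linear_extension (@subset_le 'I_n) (L_perm s).
Proof.
split.
- by move=> A; rewrite /L_perm eqxx.
- move=> A B; case: (eqVneq A B) => // nAB.
  by case: (L_permP s nAB) => M _ _ _; rewrite andbN.
- move=> B A C.
  case: (eqVneq A B) => [-> // | nAB]; case: (eqVneq B C) => [-> // | nBC].
  case: (eqVneq A C) => [-> | nAC]; first by rewrite /L_perm eqxx.
  case: (L_permP s nAB) => M1 _ max1 A1 B1; case: (L_permP s nBC) => M2 _ max2 B2 C2.
  case: (L_permP s nAC) => M _ maxM AM.
  have ne12 : perm_rank s M1 != perm_rank s M2.
    by apply: contraTneq B1 => /perm_rank_inj ->; rewrite B2 C2.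
  (* Were [M] outside [C], the three maxima would be distinct, and under every choice of the
     remaining memberships the bounds on their ranks would clash. *)
  move: (max1 M) (max1 M2) (max2 M) (max2 M1) (maxM M1) (maxM M2).
  rewrite !in_symdiff A1 B1 B2 C2 AM /=.
  case: (boolP (M \in C)) => // MC.
  have neM2 : perm_rank s M != perm_rank s M2.
    by apply: contraNneq MC => /perm_rank_inj ->.
  have neM1 : perm_rank s M != perm_rank s M1.
    by apply/eqP => /perm_rank_inj E; move: AM; rewrite MC E A1 B1.
  case: (M \in B); case: (M1 \in C); case: (M2 \in A) => /=; lia.
- move=> A B; case: (eqVneq A B) => [-> | nAB]; first by rewrite /L_perm eqxx.
  by case: (L_permP s nAB) => M _ _ _; rewrite orbN.
- move=> A B /subsetP sAB; case: (eqVneq A B) => [-> | nAB]; first by rewrite /L_perm eqxx.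
  case: (L_permP s nAB) => M _ _; have := sAB M.
  by case: (M \in A) => [-> // | _]; case: (M \in B).
Qed.

(** Let [M] be the [s]-largest and [m] the [s]-smallest element of [D]. If they differ, each [X]
    containing [m] but not [M] is reversed, which gives [2 ^ (#|D| - 2)] splits. *)
Lemma L_perm_tight s : tight (L_perm s) (L_perm (rev_perm s)).
Proof.
move=> D C D0 dDC; apply/eqP; rewrite eqn_leq card_reversed_splits_le //=;
  try exact: L_perm_linear_extension.
have [M MD maxM] := exists_rank_max (perm_rank s) D0.
have [m mD maxm] := exists_rank_max (perm_rank (rev_perm s)) D0.
(* If they coincide, [D] is a singleton and the bound is [0]. *)
have [emM | nmM] := eqVneq m M.
  have -> : D = [set M].
    apply/setP=> z; rewrite inE; apply/idP/eqP => [zD | -> //].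
    apply: (@perm_rank_inj s); apply/eqP; rewrite eqn_leq maxM //.
    by rewrite -rev_perm_rank -emM maxm.
  by rewrite cards1.
have eDX X : X \subset D -> symdiff (X :|: C) (D :\: X :|: C) = D.
  move=> /subsetP sXD; apply/setP=> z; rewrite in_symdiff !inE.
  have := sXD z; have := @disjointFl _ _ _ z dDC.
  by case: (z \in C); case: (z \in X); case: (z \in D) => //= H1 H2;
    move: (H1 isT) || move: (H2 isT).
have dM : D :\ M :\ m \subset D by rewrite setDDl subsetDl.
have -> : 2 ^ #|D| %/ 4 = #|powerset (D :\ M :\ m)|.
  rewrite card_powerset (cardsD1 M D) MD (cardsD1 m (D :\ M)) !inE nmM mD /=.
  by rewrite !add1n !expnS mulnA mulKn.
rewrite -(@card_in_imset _ _ (fun X => m |: X) (powerset (D :\ M :\ m))) => [|X Y].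
  apply/subset_leq_card/subsetP => _ /imsetP [X + ->]; rewrite inE => sX.
  have sX' : m |: X \subset D by rewrite subUset sub1set mD (subset_trans sX dM).
  rewrite !inE sX' (@L_perm_max _ _ _ M) ?eDX // (@L_perm_max _ _ _ m) ?(symdiffC (_ :\: _ :|: _)) ?eDX //.
  have MX : M \notin X by apply/negP => /(subsetP sX); rewrite !inE eqxx andbF.
  by rewrite !inE eqxx MD (negPf MX) eq_sym (negPf nmM).
rewrite !inE => sX sY E.
have mX (Z : {set 'I_n}) : Z \subset D :\ M :\ m -> m \notin Z.
  by move/subsetP=> sZ; apply/negP => /sZ; rewrite !inE eqxx.
by rewrite -(setU1K (mX _ sX)) E setU1K ?mX.
Qed.

(** * Diametral pairs as permutation pairs, up to isomorphism *)

Lemma diametral_tight L L' :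
  diametral_pair (@boolean_le n) L L' -> tight L L'.
Proof.
case=> leL leL' maxL; apply/(tightP leL leL')/eqP.
rewrite eqn_leq le_distance_max //=.
(* One pair attaining [max_distance] forces every diametral pair to attain it; the identity supplies
   one. *)
have [lex lex'] := (L_perm_linear_extension 1%g, L_perm_linear_extension (rev_perm 1%g)).
by rewrite -(proj2 (tightP lex lex') (L_perm_tight _)) maxL.
Qed.

Lemma diametral_L_perm L L' s :
  diametral_pair (@boolean_le n) L L' -> atom_order L s ->
  L =2 L_perm s /\ L' =2 L_perm (rev_perm s).
Proof.
move=> dLL' atomL; have tLL' := diametral_tight dLL'; case: dLL' => leL leL' _.
have tL'L := tightC leL leL' tLL'.
have base C := tight_base (C := C) leL leL' tLL' (@perm_rank_inj s) (rev_perm_rank s).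
have {}base C i j : i \notin C -> j \notin C -> perm_rank s i < perm_rank s j ->
    L (i |: C) (j |: C) /\ L' (j |: C) (i |: C).
  apply: base => a b rab; have := atomL ((s^-1)%g a) ((s^-1)%g b).
  by rewrite !permKV => ->; apply: ltnW.
split=> A B.
  have [<- | nAB] := eqVneq A B.
    by rewrite /L_perm eqxx (linear_extension_sub leL).
  case: (L_permP s nAB) => M MD maxM _.
  apply: (@top_splits_order _ L (perm_rank s)) => // C D M' dDC MD' maxM'.
  apply: (tight_top leL leL' tLL' (@perm_rank_inj s)) => // i j iC jC rij.
  by have [] := base C i j iC jC rij.
have [<- | nAB] := eqVneq A B.
  by rewrite /L_perm eqxx (linear_extension_sub leL').
case: (L_permP (rev_perm s) nAB) => M MD maxM _.
apply: (@top_splits_order _ L' (perm_rank (rev_perm s))) => // C D M' dDC MD' maxM'.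
apply: (tight_top leL' leL tL'L (@perm_rank_inj (rev_perm s))) => // i j iC jC rij.
by have [] // := base C j i jC iC _; rewrite ltnNge -rev_perm_rank -ltnNge.
Qed.

Lemma L_perm_diametral L L' s :
  L =2 L_perm s -> L' =2 L_perm (rev_perm s) -> diametral_pair (@boolean_le n) L L'.
Proof.
have ext K t : K =2 L_perm t -> linear_extension (@subset_le 'I_n) K.
  move=> eK; have [rL aL tL toL sL] := L_perm_linear_extension t.
  split=> [A | A B | B A C | A B | A B]; rewrite ?eK //.
  - exact: aL.
  - exact: tL.
  - exact: sL.
move=> eL eL'; split; [exact: ext eL | exact: ext eL' |] => M M' leM leM'.
rewrite (eq_le_distance eL eL').
have [lex lex'] := (L_perm_linear_extension s, L_perm_linear_extension (rev_perm s)).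
by rewrite (proj2 (tightP lex lex') (L_perm_tight _)) le_distance_max.
Qed.

(** The position of an atom is the number of atoms strictly before it in [L]. *)
Lemma exists_atom_order L :
  linear_extension (@boolean_le n) L -> exists s, atom_order L s.
Proof.
case=> rL aL tL toL _.
pose below (i : 'I_n) := [set j : 'I_n | (j != i) && L [set j] [set i]].
have belowT i : #|below i| < n.
  have : #|below i| < #|[set: 'I_n]|; last by rewrite cardsT card_ord.
  apply/proper_card/properP; split; first exact: subsetT.
  by exists i; rewrite !inE ?eqxx.
have ltL i j : i != j -> L [set i] [set j] -> #|below i| < #|below j|.
  move=> nij Lij; apply/proper_card/properP; split.
    apply/subsetP=> k; rewrite !inE => /andP [nki Lki].
    rewrite (tL _ _ _ Lki Lij) andbT; apply: contraNneq nij => ekj.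
    apply/eqP/set1_inj/aL; by rewrite Lij -ekj Lki.
  by exists i; rewrite !inE ?eqxx ?nij.
have injb : injective (fun i => Ordinal (belowT i)).
  move=> i j [eij]; apply/eqP; apply: contraT => nij.
  case/orP: (toL [set i] [set j]) => [/(ltL _ _ nij) | /ltL]; first by rewrite eij ltnn.
  by rewrite eij ltnn eq_sym nij => /(_ isT).
(* The inverse is taken because [atom_order] reads [s] as a map from positions to elements. *)
exists (perm injb)^-1%g => k l.
set i := (_ k); set j := (_ l).
have -> : k = Ordinal (belowT i) by rewrite -[RHS](permE injb) permKV.
have -> : l = Ordinal (belowT j) by rewrite -[RHS](permE injb) permKV.
rewrite /=; have [-> | nij] := eqVneq i j; first by rewrite leqnn rL.
apply/idP/idP => [/(ltL _ _ nij) /ltnW // |].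
apply: contraTT => nLij; rewrite -ltnNge; apply: ltL; first by rewrite eq_sym.
by case/orP: (toL [set i] [set j]) => //; rewrite (negPf nLij).
Qed.

(** A relabelling that preserves ranks maps the deciding element to the deciding element. *)
Lemma L_perm_imset s t (p : 'S_n) A B :
  (forall i, perm_rank t (p i) = perm_rank s i) ->
  L_perm t (p @: A) (p @: B) = L_perm s A B.
Proof.
move=> rp; have injp := @perm_inj _ p.
have [-> | nAB] := eqVneq A B; first by rewrite /L_perm !eqxx.
case: (L_permP s nAB) => M MD maxM _.
rewrite (@L_perm_max t _ _ (p M)) ?mem_imset //.
  by move: MD; rewrite !in_symdiff !mem_imset.
move=> j; rewrite -(permKV p j) in_symdiff !mem_imset // !rp => jD.
by apply: maxM; rewrite in_symdiff.
Qed.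

Lemma L_perm_isomorphic s t L L' M M' :
  L =2 L_perm s -> L' =2 L_perm (rev_perm s) ->
  M =2 L_perm t -> M' =2 L_perm (rev_perm t) ->
  isomorphic_pairs (@boolean_le n) L L' M M'.
Proof.
(* Products of permutations act from left to right, so [p] sends [s k] to [t k]; it matches the
   reversed orders as well. *)
move=> eL eL' eM eM'; pose p := (s^-1 * t)%g.
have pV i : (t^-1)%g (p i) = (s^-1)%g i by rewrite permM permK.
exists (fun A => p @: A); split=> [| A B | A B].
- split=> [|A B]; last first.
    by apply/idP/idP; [move/(imsetS (p^-1)%g) | apply: imsetS];
       rewrite // -!imset_comp !(eq_imset _ (permK p)) !imset_id.
  exists (fun A => (p^-1)%g @: A) => A; rewrite -imset_comp.
    by rewrite (eq_imset _ (permK p)) imset_id.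
  by rewrite (eq_imset _ (permKV p)) imset_id.
- by rewrite eL eM; apply: L_perm_imset => i; rewrite /perm_rank pV.
- by rewrite eL' eM'; apply: L_perm_imset => i; rewrite /perm_rank !rev_permV pV.
Qed.

End PermOrders.

Theorem theorem2 (n : nat) (hn : 1 <= n) :
  [/\ (forall (L L' : rel {set 'I_n}) (s : 'S_n),
         diametral_pair (@boolean_le n) L L' -> atom_order L s ->
         L =2 L_perm s /\ L' =2 L_perm (rev_perm s)),
      (forall L L' : rel {set 'I_n},
         diametral_pair (@boolean_le n) L L' <->
         exists s : 'S_n, L =2 L_perm s /\ L' =2 L_perm (rev_perm s))
    & (forall L L' M M' : rel {set 'I_n},
         diametral_pair (@boolean_le n) L L' ->
         diametral_pair (@boolean_le n) M M' ->
         isomorphic_pairs (@boolean_le n) L L' M M')].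
Proof.
have ex (L L' : rel {set 'I_n}) : diametral_pair (@boolean_le n) L L' ->
    exists s : 'S_n, L =2 L_perm s /\ L' =2 L_perm (rev_perm s).
  move=> dLL'; have [leL _ _] := dLL'; have [s atomL] := exists_atom_order leL.
  by exists s; apply: diametral_L_perm.
split=> [L L' s | L L' | L L' M M' /ex [s [eL eL']] /ex [t [eM eM']]].
- exact: diametral_L_perm.
- by split=> [/ex // | [s [eL eL']]]; apply: (@L_perm_diametral _ L L' s).
- exact: (L_perm_isomorphic eL eL' eM eM').
Qed.
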